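(* Let $X=F(2^{\mathbb{Z}^n})$ and let $\{\mathcal{R}_m\}_{m\ge1}$ be a sequence of marker regions for $X$ satisfying the orthogonality properties for distances $d_1<d_2<\cdots$ (where $d_{k+1}>Kd_k$ for all $k$, for a suitable constant $K=K(n)$), constructed by the layered procedure described in the context; that is, $\mathcal{R}_m=\mathcal{R}^m_1$ for a family of clopen partitions $\{\mathcal{R}^m_k\}_{1\le k\le m}$ as described there. Let $X_k=\partial\mathcal{R}_k=\bigcup\{\partial R: R\in\mathcal{R}_k\}$ and $X_k^\infty=\bigcup_{m=k}^\infty X_m$. Then the following hold. (1) $\bigcap_k X_k^\infty=\varnothing$, and for each $k$ the connected components of $X\setminus X_k^\infty$ are finite. (2) (strong orthogonality) There is a constant $\epsilon=\epsilon(n)>0$ and a function $\delta: X\times\mathbb{N}\times\mathbb{N}\to n=\{0,1,\dots,n-1\}$ such that $\delta(x,k,\ell)=0$ unless $x\in X_k^\infty$ and $\ell\le k$, and satisfying: if $k<k'$, $x\in X_k$, $x'\in X_{k'}$, then for any $\ell\le k$, if $\delta(x,k,\ell)=\delta(x',k',\ell)$, then $\rho(x,x')>\epsilon d_\ell$.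
   Context: Setting. $\mathbb{Z}^n$ acts on $2^{\mathbb{Z}^n}$ by $(g\cdot x)(h)=x(g+h)$, and $F(2^{\mathbb{Z}^n})=\{x: g\cdot x\ne x\text{ for all }g\ne 0\}$ is the free part. Its Schreier graph has edges $(x,s\cdot x)$ for $s\in\{\pm e_1,\dots,\pm e_n\}$; connectedness refers to this graph, and $\rho$ is the distance on orbits. For a subset $R$ of an orbit, $\partial R=\{x\in R: s\cdot x\notin R\text{ for some standard generator }s\}$. A rectangle is a set $Q\cdot y$ with $Q=\mathbb{Z}^n\cap\prod_i[a_i,b_i]$. A clopen partition of $X$ is a partition into finite subsets of orbits (regions) such that for each $g\in\mathbb{Z}^n$ the set of $x$ with $x$ and $g\cdot x$ in the same piece is relatively clopen in $X$. Regions that are finite unions of rectangles are also regarded as subsets of $\mathbb{R}^n$; distances between parallel faces are perpendicular distances. Orthogonality properties. For a constant $\epsilon_*>0$ depending only on $n$ the partitions $\mathcal{R}^m_k$ ($1\le k\le m$) satisfy: (a) $\mathcal{R}^m_k$ is a clopen partition of $X$, and each of its regions is a finite disjoint union of rectangles, from an auxiliary clopen rectangular partition $\tilde{\mathcal{R}}^m_k$, with side lengths between $\frac12 d_k$ and $d_k$; (b) any face of a region in $\mathcal{R}^m_k$ is at least $\epsilon_*d_k$ away from any parallel face of a nearby region in $\mathcal{R}^j_k$ for any $k\le j<m$; (c) any face $F$ of a region in $\mathcal{R}^m_k$ is at least $\epsilon_*d_k$ away from any parallel face $F'$ of a nearby region in $\mathcal{R}^m_k$ unless $\rho(F,F')\le1$.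 Construction. $\mathcal{R}^m_m$ is a clopen rectangular partition at scale $d_m$. Fix constants $\eta>0$ and $0<\epsilon_0<\epsilon_1<\dots<\epsilon_n<\frac13\eta$ depending only on $n$, with $\epsilon_j<\frac1{12}\epsilon_{j+1}$, and let $d_k'$ be given by $d_k=\epsilon_0d_k'$. Given $\mathcal{R}^m_{k+1}$, take a clopen partition of $X$ into rectangles with side lengths between $\frac12d_k'$ and $d_k'$ whose faces are at least $\eta d_k'$ from parallel faces of nearby regions in $\mathcal{R}^m_{k+1}$ and satisfy the analogues of (b),(c) with $\eta d_k'$ in place of $\epsilon_*d_k$. Say a rectangle has type $j$ if there are exactly $j$ standard unit vectors $e$ such that it meets a face, perpendicular to $e$, of some region of $\mathcal{R}^m_{k+1}$. For $j=n,n-1,\dots,1$ in turn, subdivide the current type-$j$ rectangles into rectangles with side lengths between $\frac23\epsilon_jd_k'$ and $\epsilon_jd_k'$, each of whose faces is at least $\frac14\epsilon_jd_k'$ from parallel faces of $\mathcal{R}^m_{k+1}$ regions, keeping the separation of faces of rectangles in the resulting partition from parallel faces of rectangles in the same partition (at distance $>1$) and in the corresponding level-$k$ partitions for $k\le j'<m$ at least a constant (depending only on $n$) times $d_k$. Assign each resulting rectangle, in a clopen way, to one of the regions of $\mathcal{R}^m_{k+1}$ it intersects, and replace each region $R\in\mathcal{R}^m_{k+1}$ by the union of the rectangles assigned to it; this gives $\mathcal{R}^m_k$. Finally the rectangles are further subdivided to have side lengths between $\frac12d_k$ and $d_k$, maintaining these separation properties; this gives $\tilde{\mathcal{R}}^m_k$.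 Set $\mathcal{R}_m=\mathcal{R}^m_1$. (With this construction each region of $\mathcal{R}_m$ is connected with connected boundary, in fact homeomorphic to the closed unit ball of $\mathbb{R}^n$.) *)

(* Defs.v *)
From HB Require Import structures.
From mathcomp Require Import all_boot all_order all_algebra.
From mathcomp Require Import all_classical all_reals topology ereal.
Set Implicit Arguments.
Unset Strict Implicit.
Unset Printing Implicit Defensive.
Import Order.TTheory GRing.Theory Num.Theory.
Local Open Scope classical_set_scope.
Local Open Scope ring_scope.

(** * The shift action of Z^n and its Schreier graph *)

(* 2^(Z^n) with the product topology; Z^n is 'rV[int]_n. *)
Definition cfg (n : nat) : Type := prod_topology (fun _ : 'rV[int]_n => bool).
Arguments cfg n : clear implicits.
HB.instance Definition _ n := Topological.on (cfg n).

Definition act (n : nat) (g : 'rV[int]_n) (x : cfg n) : cfg n :=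
  fun h => x (g + h).

Definition free_part (n : nat) : set (cfg n) :=
  [set x | forall g, g != 0 -> act g x <> x].
Arguments free_part n : clear implicits.

Definition rel_clopen (n : nat) (A : set (cfg n)) : Prop :=
  @clopen (subspace (free_part n)) A.

Definition unit_vec (n : nat) (i : 'I_n) : 'rV[int]_n := delta_mx 0 i.

Definition signed_unit (n : nat) (i : 'I_n) (s : 'rV[int]_n) : Prop :=
  s = unit_vec i \/ s = - unit_vec i.

Definition generator (n : nat) (s : 'rV[int]_n) : Prop :=
  exists i, signed_unit i s.

(* walk A x k y: a Schreier-graph walk with k edges from x to y inside A. *)
Inductive walk (n : nat) (A : set (cfg n)) (x : cfg n) : nat -> cfg n -> Prop :=
| walk0 : A x -> walk A x 0 x
| walkS k y s :
    walk A x k y -> generator s -> A (act s y) -> walk A x k.+1 (act s y).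

Definition conn_component (n : nat) (A : set (cfg n)) (x : cfg n)
  : set (cfg n) := [set y | exists k, walk A x k y].

(* +oo for points of different orbits *)
Definition rho (R : realType) (n : nat) (x y : cfg n) : \bar R :=
  ereal_inf [set (k%:R)%:E | k in [set k | walk setT x k y]].

Definition rho_set (R : realType) (n : nat) (A B : set (cfg n)) : \bar R :=
  ereal_inf [set r | exists x y, [/\ A x, B y & r = rho R x y]].

Definition bdry (n : nat) (A : set (cfg n)) : set (cfg n) :=
  [set x | A x /\ exists2 s, generator s & ~ A (act s x)].

(** * Rectangles and faces *)

(* A is Q . y with Q = Z^n `&` \prod_i [a_i, b_i], all b_i - a_i in [lo, hi]. *)
Definition rectangle (R : realType) (n : nat) (lo hi : R) (A : set (cfg n))
  : Prop :=
  exists y (a b : 'rV[int]_n),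
    [/\ free_part n y,
        forall i, lo <= (b 0 i - a 0 i)%:~R <= hi
      & A = [set act g y | g in
               [set g : 'rV[int]_n | forall i, a 0 i <= g 0 i <= b 0 i]]].

(* F is a face of A perpendicular to e_i.  The points of A with outward
   neighbour in direction s = e_i or - e_i contain no two points differing by
   s, so that each connected component lies in a hyperplane g_i = const. *)
Definition face (n : nat) (i : 'I_n) (A F : set (cfg n)) : Prop :=
  exists s x, [/\ signed_unit i s, A x, ~ A (act s x)
    & F = conn_component [set y | A y /\ ~ A (act s y)] x].

(* Perpendicular distance: for faces F, F' perpendicular to e_i, `|g_i| does
   not depend on the choice of x in F and act g x in F'. *)
Definition perp_dist (R : realType) (n : nat) (i : 'I_n) (F F' : set (cfg n))
  : \bar R :=
  ereal_inf [set r | exists x g, [/\ F x, F' (act g x)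
                                   & r = (`|g 0 i|%:~R)%:E]].

(* Every face of a member of P is at perpendicular distance at least c * sc
   from every parallel face of a nearby member of Q.  "Nearby" is local, on
   the faces: distance at most theta * sc.  (The regions may be much larger than
   sc, with remote faces in arbitrarily close hyperplanes.) *)
Definition faces_separated (R : realType) (n : nat) (theta c sc : R)
    (P Q : set (set (cfg n))) : Prop :=
  forall A B i F F', P A -> Q B -> face i A F -> face i B F' ->
    (rho_set R F F' <= (theta * sc)%:E)%E ->
    ((c * sc)%:E <= perp_dist R i F F')%E.

(* The same within one partition; adjacent regions have parallel faces at
   distance 1. *)
Definition faces_self_separated (R : realType) (n : nat) (theta c sc : R)
    (P : set (set (cfg n))) : Prop :=
  forall A B i F F', P A -> P B -> face i A F -> face i B F' ->
    (rho_set R F F' <= (theta * sc)%:E)%E ->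
    (perp_dist R i F F' <= 1%:E)%E \/ ((c * sc)%:E <= perp_dist R i F F')%E.

(** * Clopen partitions *)

Definition clopen_partition (n : nat) (P : set (set (cfg n))) : Prop :=
  [/\ partition P id (free_part n),
      forall A, P A -> finite_set A /\
                        exists x, A `<=` [set act g x | g in setT]
    & forall g, rel_clopen [set x | exists A, [/\ P A, A x & A (act g x)]]].

Definition rect_partition (R : realType) (n : nat) (lo hi : R)
    (P : set (set (cfg n))) : Prop :=
  clopen_partition P /\ forall A, P A -> rectangle lo hi A.

Definition refines (T : Type) (P Q : set (set T)) : Prop :=
  forall A, P A -> exists2 B, Q B & A `<=` B.

(* The type of the rectangle A with respect to the region partition Q. *)
Definition rect_type (n : nat) (Q : set (set (cfg n))) (A : set (cfg n)) : nat :=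
  #|[set i : 'I_n |
      `[< exists B F, [/\ Q B, face i B F & A `&` F !=set0] >]]%SET|.

(** * The layered construction *)

Record layer_constants (R : realType) (n : nat) := LayerConstants {
  eps_star : R;
  eta : R;
  eps_ : nat -> R;     (* only eps_ 0, ..., eps_ n matter *)
  sep_const : R;       (* the "constant depending only on n" for separations *)
  near_const : R;      (* faces within near_const * scale count as nearby *)
  eps_star_gt0 : 0 < eps_star;
  eta_gt0 : 0 < eta;
  eps0_gt0 : 0 < eps_ 0%N;
  eps_lt : forall j, (j < n)%N -> eps_ j < eps_ j.+1;
  eps_lt12 : forall j, (j < n)%N -> eps_ j < 12^-1 * eps_ j.+1;
  eps_lt_eta : eps_ n < 3^-1 * eta;
  sep_const_gt0 : 0 < sep_const;
  near_const_gt0 : 0 < near_const }.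

(* Regions are indexed as Rg m k = R^m_k and Rt m k = ~R^m_k, for
   1 <= k <= m. *)
Record orthogonality (R : realType) (n : nat) (C : layer_constants R n)
    (d : nat -> R) (Rg Rt : nat -> nat -> set (set (cfg n))) : Prop := {
  orth_clopen : forall m k, (0 < k <= m)%N -> clopen_partition (Rg m k);
  orth_aux : forall m k, (0 < k <= m)%N ->
    rect_partition (2^-1 * d k) (d k) (Rt m k);
  (* finitely many, disjoint rectangles: regions are finite and Rt m k is a
     partition *)
  orth_union : forall m k A, (0 < k <= m)%N -> Rg m k A ->
    exists2 S, S `<=` Rt m k & A = \bigcup_(B in S) B;
  orth_lower : forall m k j, (0 < k)%N -> (k <= j < m)%N ->
    faces_separated (near_const C) (eps_star C) (d k) (Rg m k) (Rg j k);
  orth_self : forall m k, (0 < k <= m)%N ->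
    faces_self_separated (near_const C) (eps_star C) (d k) (Rg m k) }.

(* P' arises from P by subdividing exactly the rectangles of type j (with
   respect to Q) into rectangles of side lengths in [2/3 w, w], with faces at
   least w/4 from parallel faces of Q, where w = e * d'. *)
Definition subdivision (R : realType) (n : nat) (theta : R) (j : nat) (e d' : R)
    (Q P P' : set (set (cfg n))) : Prop :=
  (forall A, P A -> rect_type Q A <> j -> P' A) /\
  (forall A, P' A ->
     (P A /\ rect_type Q A <> j) \/
     [/\ exists B, [/\ P B, rect_type Q B = j & A `<=` B],
         rectangle (2 / 3 * (e * d')) (e * d') A
       & faces_separated theta (4^-1 * e) d' [set A] Q]).

(* The passage from R^m_(k+1) to R^m_k.  T n is the initial rectangular
   partition at scale d' = d'_k and T j (j < n) is the partition after the
   rectangles of types n, ..., j.+1 have been subdivided; asg assigns the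
   rectangles of T 0 to regions of R^m_(k+1). *)
Record layer_step (R : realType) (n : nat) (C : layer_constants R n)
    (d : nat -> R) (Rg Rt : nat -> nat -> set (set (cfg n))) (m k : nat) (d' : R)
    (T : nat -> set (set (cfg n))) (asg : set (cfg n) -> set (cfg n)) : Prop := {
  step_scale : d k = eps_ C 0%N * d';
  step_init : rect_partition (2^-1 * d') d' (T n);
  step_init_next : faces_separated (near_const C) (eta C) d' (T n) (Rg m k.+1);
  (* j = k is excluded: R^k_k has all its faces at spacing at most
     d k < eta * d'. *)
  step_init_lower : forall j, (k < j < m)%N ->
    faces_separated (near_const C) (eta C) d' (T n) (Rg j k);
  step_init_self : faces_self_separated (near_const C) (eta C) d' (T n);
  step_clopen : forall j, (j < n)%N -> clopen_partition (T j);
  step_subdiv : forall j, (j < n)%N ->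
    subdivision (near_const C) j.+1 (eps_ C j.+1) d' (Rg m k.+1) (T j.+1) (T j);
  step_self : forall j, (j < n)%N ->
    faces_self_separated (near_const C) (sep_const C) (d k) (T j);
  (* Against the region partitions R^i_k: near a point only boundedly many of
     these have faces, whereas their underlying rectangles have faces near every
     point, for each of the unboundedly many i. *)
  step_lower : forall j i, (j < n)%N -> (k <= i < m)%N ->
    faces_separated (near_const C) (sep_const C) (d k) (T j) (Rg i k);
  step_asg : forall A, T 0%N A -> Rg m k.+1 (asg A) /\ A `&` asg A !=set0;
  step_asg_clopen : forall g,
    rel_clopen [set x | exists A, [/\ T 0%N A, A x & asg A (act g x)]];
  step_regions : Rg m k =
    [set \bigcup_(A in [set A | T 0%N A /\ asg A = B]) A | B in Rg m k.+1];
  step_final : refines (Rt m k) (T 0%N);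
  step_final_self :
    faces_self_separated (near_const C) (sep_const C) (d k) (Rt m k);
  step_final_lower : forall i, (k <= i < m)%N ->
    faces_separated (near_const C) (sep_const C) (d k) (Rt m k) (Rg i k) }.

Record layered_family (R : realType) (n : nat) (C : layer_constants R n)
    (d : nat -> R) (Rg : nat -> nat -> set (set (cfg n))) : Prop := {
  layered_rects : exists2 Rt, orthogonality C d Rg Rt &
    forall m k, (0 < k < m)%N ->
      exists d' T asg, layer_step C d Rg Rt m k d' T asg;
  layered_diag : forall m, (0 < m)%N ->
    rect_partition (2^-1 * d m) (d m) (Rg m m) }.

(* X_k, the union of the boundaries of the regions of R_k = R^k_1. *)
Definition marker_bdry (n : nat) (Rg : nat -> nat -> set (set (cfg n))) (k : nat)
  : set (cfg n) := \bigcup_(A in Rg k 1%N) bdry A.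

Definition marker_bdry_from (n : nat) (Rg : nat -> nat -> set (set (cfg n)))
    (k : nat) : set (cfg n) :=
  \bigcup_(m in [set m | (k <= m)%N]) marker_bdry Rg m.

(* Main.v *)
(** A region of [R^m_(k+1)] and the region of [R^m_k] replacing it differ only
    by rectangles of side at most [d'_k], so every boundary point of [R^m_k] is
    within a constant times [d_k] of a boundary point of [R^m_(k+1)].  As the
    [d_k] grow at least geometrically with a large ratio, a point of [X_m] is
    within a small multiple of [d_l] of a face of some region of [R^m_l]; take
    for [delta x m l] a direction perpendicular to such a face.  If the values
    for [k < k'] agree at points at distance at most [eps * d_l], then parallel
    faces of [R^k_l] and [R^k'_l] are too close, against orthogonality.
    A point lying in more than [n] of the sets [X_m] would violate this with
    [l = 1] by the pigeonhole principle.  Finally, a connected set avoiding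
    [X_k] cannot leave the region of [R_k] in which it starts. *)
Require Import Defs.
From HB Require Import structures.
From mathcomp Require Import all_boot all_order all_algebra.
From mathcomp Require Import all_classical all_reals topology ereal.
From mathcomp Require Import lra.
Set Implicit Arguments.
Unset Strict Implicit.
Unset Printing Implicit Defensive.
Import Order.TTheory GRing.Theory Num.Theory.
Local Open Scope classical_set_scope.
Local Open Scope ring_scope.

(** * The shift action and walks in the Schreier graph *)

Lemma act0 n (x : cfg n) : act 0 x = x.
Proof. by apply/funext => h; rewrite /act add0r. Qed.

Lemma actD n (g h : 'rV[int]_n) (x : cfg n) : act g (act h x) = act (g + h) x.
Proof.
apply/funext => k; congr (x _).
by rewrite addrA [h + g]addrC.
Qed.

Lemma free_part_act n (g : 'rV[int]_n) (x : cfg n) :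
  free_part n x -> free_part n (act g x).
Proof.
move=> fx h h0 e; apply: (fx h h0).
have := congr1 (act (- g)) e.
by rewrite !actD addrAC addNr add0r act0.
Qed.

Lemma generatorN n (s : 'rV[int]_n) : generator s -> generator (- s).
Proof. by case=> i [->|->]; exists i; [right|left; rewrite opprK]. Qed.

Lemma walk_trans n (A : set (cfg n)) x y z j k :
  walk A x j y -> walk A y k z -> walk A x (j + k) z.
Proof.
move=> wxy; elim=> [_|i u s _ IH gs As]; first by rewrite addn0.
by rewrite addnS; apply: walkS.
Qed.

Lemma walk_sym n (x y : cfg n) k : walk setT x k y -> walk setT y k x.
Proof.
elim=> [_|j u s _ IH gs _]; first exact: walk0.
rewrite -add1n; apply: walk_trans IH.
rewrite -[X in walk _ _ _ X]act0 -(addNr s) -actD.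
by apply: walkS => //; [exact: walk0 | exact: generatorN].
Qed.

(** Each edge changes a single coordinate by one; this bounds perpendicular distances by lengths of
    walks. *)
Lemma walk_shift n (A : set (cfg n)) x k y : walk A x k y ->
  exists2 g, y = act g x & forall i, `|g 0 i| <= k%:Z.
Proof.
elim=> [_|j u s _ [g -> IH] [i0 gs] _].
  by exists 0 => [|i]; rewrite ?act0// mxE.
exists (s + g); first by rewrite actD.
move=> i; rewrite mxE -[j.+1]add1n PoszD (le_trans (ler_normD _ _))// lerD//.
by case: gs => ->; rewrite !mxE ?normrN; case: (_ && _).
Qed.

Lemma walk_signed n (x : cfg n) s k : generator s ->
  walk setT x k (act (s *+ k) x).
Proof.
move=> gs; elim: k => [|k IH]; first by rewrite mulr0n act0; exact: walk0.
by rewrite mulrS -actD; apply: walkS.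
Qed.

Lemma walk_act n (x : cfg n) (g : 'rV[int]_n) :
  walk setT x (\sum_i `|g 0%R i|)%N (act g x).
Proof.
rewrite [X in act X x]row_sum_delta.
elim/big_rec2: _ => [|i k u _ IH]; first by rewrite act0; exact: walk0.
rewrite addnC -actD; apply: walk_trans IH _.
have gi : generator (@unit_vec n i) by exists i; left.
have -> : g 0 i *: delta_mx 0 i =
    (if 0 <= g 0 i then unit_vec i else - unit_vec i) *+ `|g 0%R i|%N.
  rewrite -scaler_nat /unit_vec; case: ifP => g0.
    by rewrite natz gez0_abs.
  rewrite scalerN -scaleNr natz ltz0_abs ?opprK//.
  by rewrite ltNge g0.
by apply: walk_signed; case: ifP => // _; exact: generatorN.
Qed.

Lemma walk_exit n (B : set (cfg n)) x k y : walk setT x k y -> B x -> ~ B y ->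
  exists j u, [/\ (j <= k)%N, walk setT x j u & bdry B u].
Proof.
move=> + Bx; elim=> [_ //|j u s wu IH gs _ nB].
have [Bu|/IH[i [v [ij wv bv]]]] := pselect (B u).
  by exists j, u; split=> //; split=> //; exists s.
by exists i, v; split=> //; exact: leqW.
Qed.

(** * Rectangles and one step of the layered construction *)

Lemma rectangle_walk (R : realType) n (lo hi : R) (A : set (cfg n)) x y :
  rectangle lo hi A -> A x -> A y ->
  exists2 k, walk setT x k y & k%:R <= n%:R * hi.
Proof.
move=> [z [a [b [fz ab ->]]]] [g gab <-] [h hab <-].
have -> : act h z = act (h - g) (act g z) by rewrite actD subrK.
eexists; first exact: walk_act.
rewrite natr_sum -[n in n%:R]card_ord -sumr_const mulr_suml.
apply: ler_sum => i _; rewrite mul1r.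
have /andP[_ le_hi] := ab i; apply: le_trans le_hi.
rewrite pmulrn ler_int abszE !mxE ler_norml.
by move: (gab i) (hab i) => /andP[? ?] /andP[? ?]; apply/andP; split; lra.
Qed.

(** Side lengths are integers, and positive as they are at least [2^-1 * w]. This serves to absorb
    the additive 1 in [bdry_next_layer]. *)
Lemma rect_partition_ge1 (R : realType) n (w : R) P x : (0 < n)%N ->
  0 < w -> @rect_partition R n (2^-1 * w) w P -> free_part n x -> 1 <= w.
Proof.
move=> n_gt0 w0 [[[cov _ _] _ _] rP]; rewrite -cov => -[A PA _].
have [y [a [b [_ /(_ (Ordinal n_gt0)) /andP[lo hi] _]]]] := rP A PA.
apply: le_trans hi; rewrite ler1z -gtz0_ge1 -(ltr0z R).
by apply: lt_le_trans lo; rewrite mulr_gt0.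
Qed.

Lemma subdivision_refines (R : realType) n (theta : R) j e d'
    (Q P P' : set (set (cfg n))) :
  subdivision theta j e d' Q P P' -> refines P' P.
Proof.
by move=> [_ h] A /h[[PA _]|[[B [PB _ AB]] _ _]]; [exists A|exists B].
Qed.

(** Subdivisions refine, so [Q] lies in a rectangle of [T n], whose sides are at most [d']. *)
Lemma layer_step_rectangle (R : realType) n (C : layer_constants R n) d Rg Rt
    m k d' T asg : layer_step C d Rg Rt m k d' T asg ->
  forall Q x y, T 0%N Q -> Q x -> Q y ->
  exists2 a, walk setT x a y & a%:R <= n%:R * d'.
Proof.
move=> st Q x y.
have [_ rT] := step_init st.
have ref j : (j <= n)%N -> refines (T 0%N) (T j).
  elim: j => [_ A TA|j IH jn]; first by exists A.
  move=> A /(IH (ltnW jn))[B TB AB].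
  have [D TD BD] := subdivision_refines (step_subdiv st jn) TB.
  by exists D => //; exact: subset_trans BD.
move=> /(ref n (leqnn n))[B /rT rB QB] /QB Bx /QB By.
exact: rectangle_walk rB Bx By.
Qed.

(** Let [x] lie in a rectangle [Q] assigned to [B], and its neighbour [act s x] in [Q'] assigned
    elsewhere. As [Q] meets [B] and [Q'] meets the other region, a walk through these two rectangles
    leaves [B], hence passes through [bdry B]. *)
Lemma bdry_next_layer (R : realType) n (C : layer_constants R n) d Rg Rt
    m k d' T asg A x : (0 < n)%N ->
  layer_step C d Rg Rt m k d' T asg -> clopen_partition (Rg m k.+1) ->
  Rg m k A -> bdry A x ->
  exists B u N, [/\ Rg m k.+1 B, bdry B u, walk setT x N u
    & N%:R <= 3 * (n%:R * d') + 1].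
Proof.
move=> n_gt0 st [[_ trivR _] _ _] + [Ax [s gs nAx]].
rewrite (step_regions st) => -[B RB AE]; rewrite -{}AE in Ax nAx.
case: Ax => Q [TQ QB] Qx.
have [[covT _ _] _ _] := step_clopen st n_gt0.
have : free_part n (act s x) by apply: free_part_act; rewrite -covT; exists Q.
rewrite -covT => -[Q' TQ' Q'sx].
have [_ [p [Qp]]] := step_asg st TQ; rewrite QB => Bp.
have [RB' [q [Q'q Bq']]] := step_asg st TQ'.
(* Otherwise disjointness gives [asg Q' = B], and [act s x] stays in the new region. *)
have nBq : ~ B q.
  move=> Bq; apply: nAx; exists Q' => //; split=> //.
  by apply: trivR => //; exists q.
have [a wa lea] := layer_step_rectangle st TQ Qx Qp.
have [b wb leb] := layer_step_rectangle st TQ' Q'sx Q'q.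
have w1 : walk setT x 1 (act s x) by apply: walkS => //; exact: walk0.
have [j [u [jle wj bu]]] :=
  walk_exit (walk_trans (walk_sym wa) (walk_trans w1 wb)) Bp nBq.
exists B, u, (a + j)%N; split=> //; first exact: walk_trans wj.
(* The stretch [a] counts twice: from [x] to [p], then back along the walk that exits [B]. *)
have : (a + j)%:R <= (a + (a + (1 + b)))%:R :> R by rewrite ler_nat leq_add2l.
by rewrite !natrD; lra.
Qed.

(** * Distances between faces, and boundaries across the layers *)

Lemma walk_rho_le (R : realType) n (x y : cfg n) k :
  walk setT x k y -> (rho R x y <= k%:R%:E)%E.
Proof. by move=> w; apply: ereal_inf_lbound; exists k. Qed.

Lemma rho_lt_walk (R : realType) n (x y : cfg n) (r : R) :
  (rho R x y < r%:E)%E -> exists2 k, walk setT x k y & k%:R < r.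
Proof. by case/ereal_inf_lt => _ [k w <-]; exists k. Qed.

(** A short walk makes the two faces nearby, so separation applies, while their perpendicular
    distance is at most the length of the walk. *)
Lemma faces_separated_walk (R : realType) n (theta c sc : R)
    (P Q : set (set (cfg n))) A B i F F' y y' N :
  faces_separated theta c sc P Q -> P A -> Q B -> face i A F -> face i B F' ->
  F y -> F' y' -> walk setT y N y' -> N%:R <= theta * sc -> c * sc <= N%:R.
Proof.
move=> sep PA QB fF fF' Fy F'y' w Nle.
rewrite -lee_fin; apply: (le_trans (sep _ _ _ _ _ PA QB fF fF' _)).
  apply: (@le_trans _ _ (rho R y y')).
    by apply: ereal_inf_lbound; exists y, y'.
  by apply: (le_trans (walk_rho_le R w)); rewrite lee_fin.
have [g yg /(_ i) leg] := walk_shift w.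
apply: (@le_trans _ _ (`|g 0 i|%:~R)%:E).
  by apply: ereal_inf_lbound; exists y, g; rewrite -yg.
by rewrite lee_fin pmulrn ler_int.
Qed.

Lemma bdry_face n (A : set (cfg n)) u :
  bdry A u -> exists i F, face i A F /\ F u.
Proof.
move=> [Au [s [i si] nAu]]; exists i.
exists (conn_component [set y | A y /\ ~ A (act s y)] u).
by split; [exists s, u | exists 0%N; exact: walk0].
Qed.

Lemma conn_component_sub n (A B : set (cfg n)) x :
  B x -> A `&` bdry B = set0 -> conn_component A x `<=` B.
Proof.
move=> Bx AB y [k]; elim=> // j u s w Bu gs _.
apply: contrapT => nB; have : (A `&` bdry B) u.
  by split; [case: w | split=> //; exists s].
by rewrite AB.
Qed.

(** With [d' = d k / eps_ C 0] and [1 <= d k], the bound [3 * (n * d') + 1] of [bdry_next_layer] is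
    at most [layer_gap C * d k]. *)
Definition layer_gap (R : realType) n (C : layer_constants R n) : R :=
  3 * n%:R / eps_ C 0%N + 1.

Lemma layer_gap_ge0 (R : realType) n (C : layer_constants R n) :
  0 <= layer_gap C.
Proof. by rewrite addr_ge0// divr_ge0 ?mulr_ge0// ltW// eps0_gt0. Qed.

(** Induction on [l]: a walk of length at most [mu * d l] is prolonged by at most
    [layer_gap C * d l], and the growth of [d] keeps the sum below [mu * d l.+1]. *)
Lemma bdry_near_layer (R : realType) n (C : layer_constants R n)
    (d : nat -> R) Rg (mu : R) m A x l : (0 < n)%N -> 0 < mu ->
  (forall k, (0 < k)%N -> 0 < d k) ->
  (forall k, (0 < k)%N -> (mu + layer_gap C) * d k <= mu * d k.+1) ->
  layered_family C d Rg -> Rg m 1%N A -> bdry A x -> (0 < l <= m)%N ->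
  exists B u N, [/\ Rg m l B, bdry B u, walk setT x N u & N%:R <= mu * d l].
Proof.
move=> n_gt0 mu0 d0 dS [[Rt orth steps] _] RA bA.
elim: l => // -[_ /= m0|l IH /= lm].
  exists A, x, 0%N; split=> //; first exact: walk0.
  by rewrite mulr_ge0 ?ltW// d0.
have lm' : (0 < l.+1 <= m)%N by exact: ltnW.
have [B [u [N [RB bB wN leN]]]] := IH lm'.
have [d' [T [asg st]]] := steps m l.+1 lm.
have [D [v [M [RD bD wM leM]]]] :=
  bdry_next_layer n_gt0 st (orth_clopen orth (k := l.+2) lm) RB bB.
exists D, v, (N + M)%N; split=> //; first exact: walk_trans wM.
have fu : free_part n u.
  have [[<- _ _] _ _] := orth_clopen orth lm'.
  by exists B => //; case: bB.
have d1 := rect_partition_ge1 n_gt0 (d0 l.+1 isT) (orth_aux orth lm') fu.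
have d'E : d' = d l.+1 / eps_ C 0%N.
  by rewrite (step_scale st) mulrC mulKf// gt_eqF// eps0_gt0.
apply: le_trans (dS l.+1 isT); rewrite natrD mulrDl; apply: lerD => //.
apply: (le_trans leM); rewrite d'E [_ * d _]mulrDl mul1r; apply: lerD => //.
by rewrite !mulrA mulrAC.
Qed.

Theorem theorem3p1 (R : realType) (n : nat) (n_gt0 : (0 < n)%N)
    (C : layer_constants R n) :
  exists K eps : R, 0 < eps /\
  forall (d : nat -> R) (Rg : nat -> nat -> set (set (cfg n))),
    0 < d 1%N ->
    (forall k, (0 < k)%N -> d k < d k.+1) ->
    (forall k, (0 < k)%N -> K * d k < d k.+1) ->
    layered_family C d Rg ->
    (\bigcap_(k in [set k | (0 < k)%N]) marker_bdry_from Rg k = set0 /\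
     forall k x, (0 < k)%N -> (free_part n `\` marker_bdry_from Rg k) x ->
       finite_set (conn_component (free_part n `\` marker_bdry_from Rg k) x)) /\
    exists delta : cfg n -> nat -> nat -> 'I_n,
      (forall x k l, free_part n x -> (0 < k)%N -> (0 < l)%N ->
         ~ (marker_bdry_from Rg k x /\ (l <= k)%N) ->
         delta x k l = 0%N :> nat) /\
      (forall x x' k k' l, (0 < l <= k)%N -> (k < k')%N ->
         marker_bdry Rg k x -> marker_bdry Rg k' x' ->
         delta x k l = delta x' k' l ->
         ((eps * d l)%:E < rho R x x')%E).
Proof.
(* Two parallel faces will be joined by a walk shorter than [4 * mu * d l]; dividing by 5 keeps it
   below both constants times [d l]. *)
pose mu := Num.min (near_const C) (eps_star C) / 5.
have mu0 : 0 < mu by rewrite divr_gt0// lt_min near_const_gt0 eps_star_gt0.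
exists ((mu + layer_gap C) / mu), mu; split=> // d Rg d1 dS KdS fam.
have d0 k : (0 < k)%N -> 0 < d k.
  by elim: k => // -[//|k] IH _; apply: lt_trans (IH isT) _; exact: dS.
have gap k : (0 < k)%N -> (mu + layer_gap C) * d k <= mu * d k.+1.
  by move=> /KdS /ltW; rewrite mulrAC ler_pdivrMr// [_ * mu]mulrC.
have [[Rt orth _] _] := fam.
pose close x m l := [set i | exists B F u N,
  [/\ Rg m l B, face i B F, F u, walk setT x N u & N%:R <= mu * d l]].
pose i0 := Ordinal n_gt0.
(* [i0] is the value 0 prescribed off the boundary. The test is membership in [X_k] itself, a subset
   of [X_k^\infty]. *)
pose delta x k l : 'I_n :=
  if `[< marker_bdry Rg k x /\ (0 < l <= k)%N >] then xget i0 (close x k l)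
  else i0.
have deltaP x k l : (0 < l <= k)%N -> marker_bdry Rg k x ->
    close x k l (delta x k l).
  move=> lk bx; rewrite /delta asboolT//.
  have [A RA bA] := bx.
  have [B [u [N [RB bB wN leN]]]] :=
    bdry_near_layer n_gt0 mu0 d0 gap fam RA bA lk.
  have [i [F [fF Fu]]] := bdry_face bB.
  by apply: (xgetPex i0); exists i, B, F, u, N.
have strong x x' k k' l : (0 < l <= k)%N -> (k < k')%N ->
    marker_bdry Rg k x -> marker_bdry Rg k' x' ->
    delta x k l = delta x' k' l -> ((mu * d l)%:E < rho R x x')%E.
  move=> lk kk' bx bx' e; rewrite ltNge; apply/negP => rho_le.
  have /andP[l0 lek] := lk.
  have mud : 0 < mu * d l by rewrite mulr_gt0 ?d0.
  (* The infimum yields a walk only below a strict bound, hence the factor 2. *)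
  have [|N w ltN] := @rho_lt_walk R n x x' (2 * (mu * d l)).
    by apply: le_lt_trans rho_le _; rewrite lte_fin; lra.
  have [B [F [u [M [RB fF Fu wu leM]]]]] := deltaP _ _ _ lk bx.
  have lk' : (0 < l <= k')%N by rewrite l0 (leq_trans lek)// ltnW.
  have := deltaP _ _ _ lk' bx'; rewrite -e.
  move=> [B' [F' [u' [M' [RB' fF' F'u' wu' leM']]]]].
  have /(orth_lower orth l0) sep : (l <= k < k')%N by rewrite lek.
  have wuu' := walk_trans (walk_sym wu') (walk_trans (walk_sym w) wu).
  have lt_min_d : (M' + (N + M))%:R < Num.min (near_const C) (eps_star C) * d l.
    by rewrite -[Num.min _ _](divfK (_ : 5 != 0))// -/mu !natrD; lra.
  have le_near : Num.min (near_const C) (eps_star C) * d l <=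
      near_const C * d l.
    by rewrite ler_wpM2r ?ge_min ?lexx// ltW// d0.
  have le_star : Num.min (near_const C) (eps_star C) * d l <= eps_star C * d l.
    by rewrite ler_wpM2r ?ge_min ?lexx ?orbT// ltW// d0.
  have :=
    faces_separated_walk sep RB' RB fF' fF F'u' Fu wuu'.
  move=> /(_ (ltW (lt_le_trans lt_min_d le_near))).
  by rewrite leNgt (lt_le_trans lt_min_d).
split; last first.
  exists delta; split=> // x k l fx k0 l0 nb.
  rewrite /delta asboolF// => -[bx /andP[_ lk]]; apply: nb; split=> //.
  by exists k => /=.
split.
  rewrite -subset0 => x inX.
  have ex k : exists m, (k < m)%N /\ marker_bdry Rg m x.
    by have [m km bm] := inX k.+1 isT; exists m.
  have [f fP] := choice ex.
  (* [f k] is an index beyond [k] whose boundary contains [x]; starting with one iteration makes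
     every [g i] such an index, and positive. *)
  pose g i := iter i.+1 f 0%N.
  have g_bdry i : marker_bdry Rg (g i) x by have [] := fP (iter i f 0%N).
  have g_homo i j : (i < j)%N -> (g i < g j)%N.
    elim: j => // j IH; have [gS _] := fP (g j).
    by rewrite ltnS leq_eqVlt => /predU1P[->//|/IH ij]; exact: ltn_trans gS.
  have lt_neq i j : (i < j)%N -> delta x (g i) 1%N <> delta x (g j) 1%N.
    move=> ij e.
    have g0 : (0 < 1 <= g i)%N by exact: leq_ltn_trans (leq0n _) (fP _).1.
    (* Both points are [x], at distance 0 from itself. *)
    have := strong _ _ _ _ _ g0 (g_homo _ _ ij) (g_bdry i) (g_bdry j) e.
    apply/negP; rewrite -leNgt.
    apply: (le_trans (walk_rho_le R (walk0 (A := setT) I))).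
    by rewrite lee_fin mulr_ge0 ?ltW// d0.
  have inj : injective (fun i : 'I_n.+1 => delta x (g i) 1%N).
    move=> i j e; apply: val_inj.
    by case: (ltngtP i j) => [/lt_neq/(_ e)|/lt_neq/(_ (esym e))|].
  by have := leq_card _ inj; rewrite !card_ord ltnn.
move=> k x k0 [fx nx].
have k1 : (0 < 1 <= k)%N by [].
have [[cov _ _] fin _] := orth_clopen orth k1.
have : free_part n x by [].
rewrite -{1}cov => -[A RA Ax].
apply: sub_finite_set (fin A RA).1; apply: conn_component_sub => //.
rewrite -subset0 => y [[_ ny] bd]; apply: ny; exists k => //=.
by exists A.
Qed.
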